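(* If $X$ is an FLS space with scattered height $\hbar[X]$, then $|X|\le\mathfrak c$, $\hbar[X]<\mathfrak c^+$ and $\mathrm{cf}(\hbar[X])\le\omega$.
   Context: $\mathfrak c$ is the cardinality of the continuum and $\mathfrak c^+$ its successor cardinal. $\mathrm{cf}$ is cofinality, with $\mathrm{cf}(0)=0$ and $\mathrm{cf}(\alpha)=1$ for successor ordinals $\alpha$. All spaces are Hausdorff topological spaces. For a space $X$, $X^{(1)}$ is the set of non-isolated points of $X$; $X^{(0)}=X$ and $X^{(\alpha)}=\bigcap_{\xi<\alpha}(X^{(\xi)})^{(1)}$ for ordinals $\alpha>0$. $X$ is scattered if every nonempty subspace has an isolated point; the scattered height $\hbar[X]$ of a scattered space $X$ is the smallest ordinal $\alpha$ with $X^{(\alpha)}=\emptyset$. An FLS space is a first-countable Lindelöf scattered (Hausdorff) space. *)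

(* Defs.v *)
From mathcomp Require Import all_boot all_order all_algebra.
From mathcomp Require Import all_classical wochoice.
From mathcomp Require Import reals topology.

Set Implicit Arguments.
Unset Strict Implicit.
Unset Printing Implicit Defensive.

Local Open Scope classical_set_scope.
Local Open Scope card_scope.

(** * Ordinals *)

(* An ordinal is represented by a (strictly) well-ordered type; two isomorphic
   well-ordered types represent the same ordinal, and all notions below are
   invariant under isomorphism.  The elements of [a : Ord] stand for the
   ordinals smaller than [a] (see [Ord_lt_iseg] and [iseg_Ord_lt]).

   Collections of ordinals are written [Ord -> Prop] and not [set Ord], and
   [Ord] is not made a [choiceType]: either would put a universe constraint on
   the (monomorphic) structures of the library. *)
Record Ord := MkOrd {
  Ord_sort :> Type;
  olt : Ord_sort -> Ord_sort -> Prop;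
  olt_wf : well_founded olt;
  olt_trans : forall x y z, olt x y -> olt y z -> olt x z;
  olt_total : forall x y, olt x y \/ x = y \/ olt y x }.

Arguments olt {o} _ _.
Arguments olt_wf {o} _.

Definition Ord_le (a b : Ord) : Prop :=
  exists f : a -> b, (forall x y, olt x y -> olt (f x) (f y)) /\
    (forall x z, olt z (f x) -> exists y, f y = z).

Definition Ord_lt (a b : Ord) : Prop :=
  exists (f : a -> b) (c : b), (forall x y, olt x y -> olt (f x) (f y)) /\
    (forall z, olt z c <-> exists y, f y = z).

Definition Ord0 : Ord.
Proof. by apply: (@MkOrd False (fun _ _ => False)); case. Defined.

Definition omega : Ord.
Proof.
apply: (@MkOrd nat (fun m n => (m < n)%N)).
- move=> n; have [k] := ubnP n; elim: k n => [n|k IH n nk]; first by rewrite ltn0.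
  by constructor => m mn; apply: IH; apply: leq_trans mn _.
- by move=> x y z; exact: ltn_trans.
- by move=> x y; case: (ltngtP x y) => xy; [left|right; right|right; left].
Defined.

Definition is_least (P : Ord -> Prop) (a : Ord) : Prop :=
  P a /\ forall b, P b -> Ord_le a b.

(* The least ordinal satisfying [P], and [Ord0] when there is none; by
   [leastP] the second case occurs only when no ordinal satisfies [P]. *)
Definition least (P : Ord -> Prop) : Ord :=
  match pselect (exists a, is_least P a) with
  | left e => projT1 (cid e)
  | right _ => Ord0
  end.

(* The cofinality of [a] is the least ordinal admitting a map into [a] with
   cofinal range; in particular it is 0 for 0 and 1 for successors. *)
Definition cf (a : Ord) : Ord :=
  least (fun b => exists f : b -> a, forall x, exists y, x = f y \/ olt x (f y)).

(* The initial ordinal [|T|^+]: the least ordinal of cardinality not [<= |T|]. *)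
Definition card_succ (T : Type) : Ord :=
  least (fun a => ~ ([set: a] #<= [set: T])).

(** * Topology *)

Section Topology.
Context {X : topologicalType}.

Definition first_countable : Prop :=
  forall x : X, exists2 B : set (set X), countable B & filter_from B id = nbhs x.

Definition Lindelof : Prop :=
  forall F : set (set X), F `<=` open -> cover F id = [set: X] ->
    exists G : set (set X), [/\ G `<=` F, countable G & cover G id = [set: X]].

Definition scattered : Prop :=
  forall A : set X, A !=set0 -> isolated A !=set0.

Definition non_isolated (A : set X) : set X := A `\` isolated A.

(* [CB_below x], for [x] in a well-ordered type, is [X^(xi)] where [xi] is the
   order type of the elements below [x]. *)
Definition CB_below (a : Ord) : a -> set X :=
  Fix olt_wf (fun _ : a => set X)
    (fun x D => [set p | forall y (yx : olt y x), non_isolated (D y yx) p]).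

(* [X^(a)].  The case [a = 0] gives the whole space; [CB_derivE] is the
   recursive equation with the index ranging over all ordinals [b < a]. *)
Definition CB_deriv (a : Ord) : set X :=
  \bigcap_(x in [set: a]) non_isolated (CB_below x).

End Topology.

Arguments first_countable : clear implicits.
Arguments Lindelof : clear implicits.
Arguments scattered : clear implicits.
Arguments CB_deriv : clear implicits.

Definition FLS (X : topologicalType) : Prop :=
  [/\ hausdorff_space X, first_countable X, Lindelof X & scattered X].

Definition scattered_height (X : topologicalType) : Ord :=
  least (fun a => CB_deriv X a = set0).

(** * Basic facts: the definitions above are never degenerate *)

Lemma olt_ind (a : Ord) (P : a -> Prop) :
  (forall x, (forall y, olt y x -> P y) -> P x) -> forall x, P x.
Proof. exact: (well_founded_ind (olt_wf (o := a))). Qed.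

Lemma olt_irr (a : Ord) (x : a) : ~ olt x x.
Proof. by elim/olt_ind: x => x IH xx; exact: (IH x xx xx). Qed.

Lemma olt_min (a : Ord) (P : a -> Prop) : (exists x, P x) ->
  exists x, P x /\ forall y, olt y x -> ~ P y.
Proof.
move=> [x]; elim/olt_ind: x => x IH Px.
have [[y [yx Py]]|H] := pselect (exists y, olt y x /\ P y); first exact: IH Py.
by exists x; split => // y yx Py; apply: H; exists y.
Qed.

Section Segments.
Variables (a : Ord) (c : a).

Definition iseg : Ord.
Proof.
apply: (@MkOrd {x : a | olt x c} (fun x y => olt (sval x) (sval y))).
- move=> [x xc]; elim/olt_ind: x xc => x IH xc.
  by constructor => -[y yc] /= yx; exact: IH.
- by move=> x y z; exact: olt_trans.
- move=> [x xc] [y yc] /=.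
  case: (olt_total x y) => [|[xy|]]; [by left| |by right; right].
  by right; left; subst y; congr exist; exact: Prop_irrelevance.
Defined.

Lemma iseg_Ord_lt : Ord_lt iseg a.
Proof.
exists (fun x : iseg => sval x), c; split => // z; split => [zc|[[y yc] <-] //].
by exists (exist _ z zc).
Qed.

End Segments.

Lemma Ord_lt_iseg (a b : Ord) : Ord_lt a b ->
  exists c : b, Ord_le a (iseg c) /\ Ord_le (iseg c) a.
Proof.
move=> [f [c [fmono frange]]].
have fc x : olt (f x) c by apply/frange; exists x.
exists c; split.
  exists (fun x => exist (fun z => olt z c) (f x) (fc x)); split => //=.
  move=> x [z zc] /= zx; have [y yz] := (frange z).1 zc.
  by exists y; subst z; congr exist; exact: Prop_irrelevance.
have finv (z : iseg c) : exists y, f y = sval z.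
  by case: z => z zc; exact: (frange z).1.
pose g z := projT1 (cid (finv z)).
have gP z : f (g z) = sval z by rewrite /g; case: (cid _).
exists g; split.
  move=> x y xy; have := olt_total (g x) (g y).
  case=> [//|[e|/fmono]]; last first.
    by rewrite !gP => yx; case: (olt_irr (olt_trans yx xy)).
  by move: xy; rewrite /= -!gP e => /olt_irr.
move=> x z _; exists (exist _ (f z) (fc z)).
have := olt_total (g (exist _ (f z) (fc z))) z.
by case=> [/fmono|[//|/fmono]]; rewrite gP => /olt_irr.
Qed.

Section Comparison.

Inductive sim (a b : Ord) : a -> b -> Prop :=
  Sim x y : (forall x', olt x' x -> exists2 y', olt y' y & sim x' y') ->
            (forall y', olt y' y -> exists2 x', olt x' x & sim x' y') -> sim x y.

Lemma sim_l (a b : Ord) (x : a) (y : b) : sim x y ->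
  forall x', olt x' x -> exists2 y', olt y' y & sim x' y'.
Proof. by case. Qed.

Lemma sim_r (a b : Ord) (x : a) (y : b) : sim x y ->
  forall y', olt y' y -> exists2 x', olt x' x & sim x' y'.
Proof. by case. Qed.

Lemma sim_sym (a b : Ord) (x : a) (y : b) : sim x y -> sim y x.
Proof.
elim/olt_ind: x y => x IH y s; constructor => z zz.
  by have [x' x'x s'] := sim_r s zz; exists x' => //; exact: IH.
by have [y' y'y s'] := sim_l s zz; exists y' => //; exact: IH.
Qed.

Lemma sim_inj (a b : Ord) (x x' : a) (y : b) : sim x y -> sim x' y -> x = x'.
Proof.
elim/olt_ind: y x x' => y IH.
have H (x x' : a) : sim x y -> sim x' y -> ~ olt x' x.
  move=> s s' lt; have [y1 y1y s1] := sim_l s lt.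
  have [x2 x2x' s2] := sim_r s' y1y.
  by move: x2x'; rewrite (IH _ y1y _ _ s1 s2) => /olt_irr.
by move=> x x' s s'; case: (olt_total x x') => [/H|[//|/H]]; case.
Qed.

Lemma sim_fun (a b : Ord) (x : a) (y y' : b) : sim x y -> sim x y' -> y = y'.
Proof. by move=> /sim_sym s /sim_sym; exact: sim_inj. Qed.

Lemma Ord_leVlt (a b : Ord) : Ord_le a b \/ Ord_lt b a.
Proof.
have [H|] := pselect (forall x : a, exists y : b, sim x y).
  left; pose f x := projT1 (cid (H x)).
  have fP x : sim x (f x) by rewrite /f; case: (cid _).
  exists f; split.
    move=> x y xy; have [z zy s] := sim_l (fP y) xy.
    by rewrite (sim_fun (fP x) s).
  move=> x z zx; have [y yx s] := sim_r (fP x) zx.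
  by exists y; exact: sim_fun (fP y) s.
move/existsNP/olt_min => [x [Nx xmin]]; right.
have {}xmin x' : olt x' x -> exists y : b, sim x' y.
  by move=> /xmin/contrapT.
have H (y : b) : exists x' : a, olt x' x /\ sim x' y.
  apply: contrapT => Hy.
  have [{Hy}y [Ny ymin]] := olt_min (ex_intro (fun y => ~ _) y Hy).
  apply: Nx; exists y; constructor.
    move=> x' x'x; have [y' s] := xmin _ x'x.
    case: (olt_total y' y) => [?|[e|yy']]; first by exists y'.
      by case: Ny; exists x'; rewrite -e.
    have [x2 x2x' s2] := sim_r s yy'; case: Ny; exists x2; split => //.
    exact: olt_trans x2x' x'x.
  by move=> y' /ymin/contrapT[x' [? ?]]; exists x'.
pose f y := projT1 (cid (H y)).
have fP y : olt (f y) x /\ sim (f y) y by rewrite /f; case: (cid _).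
exists f, x; split.
  move=> y y' yy'; have [z zy s] := sim_r (fP y').2 yy'.
  by rewrite (sim_inj (fP y).2 s).
move=> z; split => [zx|[y <-]]; last exact: (fP y).1.
have [y s] := xmin _ zx; exists y; exact: sim_inj (fP y).2 s.
Qed.

End Comparison.

Lemma is_least_ex (P : Ord -> Prop) : (exists a, P a) -> exists a, is_least P a.
Proof.
move=> [a Pa].
pose Q (c : a) := exists (b : Ord) (f : b -> a), P b /\
  ((forall x y, olt x y -> olt (f x) (f y)) /\
    forall z, olt z c <-> exists y, f y = z).
have [H|NQ] := pselect (exists c, Q c); last first.
  exists a; split => // b Pb; case: (Ord_leVlt a b) => // -[f [c fc]].
  by case: NQ; exists c, b, f.
have [c [[b [f [Pb [fmono frange]]]] cmin]] := olt_min H.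
exists b; split => // d Pd; case: (Ord_leVlt b d) => // -[g [e [gmono grange]]].
case: (cmin (f e)); first by apply/frange; exists e.
exists d, (fun x => f (g x)); split => //; split.
  by move=> x y /gmono/fmono.
move=> z; split => [ze|[y <-]]; last by apply: fmono; apply/grange; exists y.
have [y fy] := (frange z).1 (olt_trans ze ((frange (f e)).2 (ex_intro _ e erefl))).
have /grange[u gu] : olt y e.
  move: ze; rewrite -fy; case: (olt_total y e) => [//|[->|/fmono ey fye]].
    by move/olt_irr.
  by case: (olt_irr (olt_trans ey fye)).
by exists u; rewrite gu.
Qed.

Lemma leastP (P : Ord -> Prop) : (exists a, P a) -> is_least P (least P).
Proof.
move=> /is_least_ex h; rewrite /least; case: pselect => // e.
by case: (cid e).
Qed.

Lemma cfP (a : Ord) : is_least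
  (fun b => exists f : b -> a, forall x, exists y, x = f y \/ olt x (f y)) (cf a).
Proof. by apply: leastP; exists a, id => x; exists x; left. Qed.

(* Every type carries a well-order, and no injection goes from the powerset of
   [T] to [T]. *)
Lemma Ord_on (T : Type) : exists (a : Ord) (f : T -> a), injective f.
Proof.
have [R Rwo] := well_ordering_principle {classic T}.
have Rmin (P : T -> Prop) : (exists x, P x) ->
    exists x, P x /\ forall y, P y -> R x y.
  move=> [x Px]; have [|z [[Az zmin] _]] := Rwo (fun x => `[<P x>]).
    by exists x; apply/asboolP.
  exists z; split; first exact/asboolP.
  by move=> y Py; apply: zmin; apply/asboolP.
have Rchain : wo_chain R predT by apply: withinW.
have Ranti x y : R x y -> R y x -> x = y.
  move=> xy yx; apply: (@wo_chain_antisymmetric _ R predT Rchain) => //.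
  by rewrite xy yx.
have Rtot x y : R x y \/ R y x.
  by apply/orP; exact: (wo_chainW Rchain).
pose S (x y : T) := R x y /\ x <> y.
have Swf : well_founded S.
  move=> x; apply: contrapT => Nx.
  have [z [Nz zmin]] := Rmin (fun x => ~ Acc S x) (ex_intro _ x Nx).
  apply: Nz; constructor => y [Ryz yz]; apply: contrapT => /zmin Rzy.
  exact/yz/Ranti.
have Stot x y : S x y \/ x = y \/ S y x.
  have [->|xy] := pselect (x = y); first by right; left.
  by case: (Rtot x y) => ?; [left|right; right]; split => // e; exact: xy.
have Str x y z : S x y -> S y z -> S x z.
  move=> xy yz; case: (Stot x z) => // -[e|zx].
    by move: xy.2; rewrite (Ranti x y xy.1) // e; exact: yz.1.
  have [t [[->|[->|->]] tmin]] :=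
    Rmin (fun w => w = x \/ w = y \/ w = z) (ex_intro _ x (or_introl erefl)).
  - by case: zx => zx []; apply: Ranti => //; apply: tmin; right; right.
  - by case: xy => xy []; apply: Ranti => //; apply: tmin; left.
  - by case: yz => yz []; apply: Ranti => //; apply: tmin; right; left.
by exists (@MkOrd T S Swf Str Stot), id.
Qed.

Lemma Cantor_Ord (T : Type) : exists a : Ord, forall f : a -> T, ~ injective f.
Proof.
have [a [g ginj]] := Ord_on (T -> Prop); exists a => f finj.
pose h (A : T -> Prop) := f (g A).
have hinj : injective h by move=> A B /finj/ginj.
pose D t := exists A, h A = t /\ ~ A t.
have : ~ D (h D) by move=> HD; case: (HD) => A [/hinj -> ].
by move=> ND; apply: (ND); exists D.
Qed.

Lemma card_succP (T : Type) :
  is_least (fun a => ~ ([set: a] #<= [set: T])) (card_succ T).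
Proof.
apply: leastP; have [a Na] := Cantor_Ord T; exists a.
move=> /card_leP/unsquash f.
apply: (Na (fun x => sval (f (exist _ x (mem_setT x))))) => x y /= fxy.
have /(@inj _ _ _ f) : f (exist _ x (mem_setT x)) = f (exist _ y (mem_setT y)).
  exact: val_inj.
by move=> /(_ (mem_setT _) (mem_setT _)) [].
Qed.

Section Derivatives.
Context {X : topologicalType}.

Lemma CB_belowE (a : Ord) (x : a) : CB_below (X := X) x =
  [set p | forall y, olt y x -> non_isolated (CB_below y) p].
Proof.
rewrite /CB_below Fix_eq // => z D D' DD'; congr mkset.
by apply: funext => p; apply: eq_forall => y; apply: eq_forall => yz; rewrite DD'.
Qed.

Lemma CB_below_emb (a b : Ord) (f : a -> b) :
  (forall x y, olt x y -> olt (f x) (f y)) ->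
  (forall x z, olt z (f x) -> exists y, f y = z) ->
  forall x, CB_below (X := X) (f x) = CB_below x.
Proof.
move=> fmono frange x; elim/olt_ind: x => x IH.
rewrite !CB_belowE; apply/seteqP; split => p H y yx.
  by rewrite -IH //; apply: H; exact: fmono.
have [z zy] := frange _ _ yx; rewrite -zy in yx *.
have zx : olt z x.
  case: (olt_total z x) => [//|[e|/fmono xz]].
    by move: yx; rewrite e => /olt_irr.
  by case: (olt_irr (olt_trans xz yx)).
by rewrite IH //; exact: H.
Qed.

Lemma CB_deriv_seg (a b : Ord) (f : a -> b) (c : b) :
  (forall x y, olt x y -> olt (f x) (f y)) ->
  (forall z, olt z c <-> exists y, f y = z) ->
  CB_deriv X a = CB_below c.
Proof.
move=> fmono frange; have fE x : CB_below (X := X) (f x) = CB_below x.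
  apply: CB_below_emb => // y z zy; apply/frange; apply: olt_trans zy _.
  by apply/frange; exists y.
rewrite CB_belowE; apply/seteqP; split => p H.
  by move=> y /frange[x <-]; rewrite fE; exact: H.
by move=> x _; rewrite -fE; apply: H; apply/frange; exists x.
Qed.

Lemma CB_derivE (a : Ord) (p : X) :
  CB_deriv X a p <-> forall b, Ord_lt b a -> non_isolated (CB_deriv X b) p.
Proof.
split=> [H b [f [c [fmono frange]]]|H x _].
  by rewrite (CB_deriv_seg fmono frange); exact: H.
have [f [c [fmono frange]]] := iseg_Ord_lt x.
have sx : @CB_deriv X (iseg x) = CB_below x.
  apply: (CB_deriv_seg (f := fun y : iseg x => sval y)) => //.
  by move=> z; split => [zx|[[y yx] <-]//]; exists (exist _ z zx).
by rewrite -sx; exact/H/iseg_Ord_lt.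
Qed.

Lemma scattered_heightP : scattered X ->
  is_least (fun a => CB_deriv X a = set0) (scattered_height X).
Proof.
move=> sX; apply: leastP; have [a Na] := Cantor_Ord X; exists a.
apply/seteqP; split => // p pa.
have ne (x : a) : CB_below (X := X) x !=set0 by exists p; have [] := pa x I.
pose f x := projT1 (cid (sX _ (ne x))).
have fP x : isolated (CB_below x) (f x) by rewrite /f; case: (cid _).
have fN x y : olt x y -> f x <> f y.
  move=> xy fxy; have := isolatedS (fP y); rewrite CB_belowE => /(_ _ xy) [_].
  by rewrite -fxy; apply; exact: fP.
apply: (Na f) => x y fxy; case: (olt_total x y) => [/fN//|[//|/fN]].
by rewrite fxy.
Qed.

End Derivatives.

(* Main.v *)
Require Import Defs.
From mathcomp Require Import all_boot all_order all_algebra.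
From mathcomp Require Import all_classical.
From mathcomp Require Import reals topology.
From mathcomp Require Import lra.

(** The bound [|X| <= c] is Arhangel'skii's theorem and uses only that [X] is
    Hausdorff, first countable and Lindelof.  Fix a countable base at every
    point.  Consider the operation sending a sequence to its limit and, for
    each sequence [g] of base indices, the operation sending a sequence [u] of
    points to a point outside the union of the [g n]-th basic neighbourhoods
    of the [u n], if there is one.  These are continuum many operations of
    countable arity, so the set [A] generated by a point under them has at most
    [c] elements ([omega_ary_closure]): each of its elements is the value of a
    well-founded countably branching term, and such a term is determined by the
    set of its labelled nodes, which is coded by a set of natural numbers.  Now
    [A] is closed, since it contains limits of its sequences.  If it missed a
    point [q], then [A] would be covered by countably many basic neighbourhoods
    of its points that avoid [q]; the corresponding operation would return an
    element of [A] outside all of them, which is absurd.  So [A] is the whole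
    space ([Arhangelskii]).

    For the other two claims let [h] be the height.  By minimality of [h], the
    derivatives indexed by elements of [h] are nonempty, so by scatteredness
    each has an isolated point.  That point is lost in all later derivatives,
    so distinct indices yield distinct points and [|h| <= |X| <= c], whence
    [h < c^+].  Finally the derivatives are closed, and so are the sets of their
    non-isolated points; taken over all indices below [h], the latter sets have
    empty intersection, so their complements form an open cover.  A countable
    subcover gives a countable set of indices which is cofinal in [h], as a
    strict upper bound for it in [h] would index an empty derivative. *)

Set Implicit Arguments.
Unset Strict Implicit.
Unset Printing Implicit Defensive.

Import Order.TTheory GRing.Theory Num.Theory.

Local Open Scope classical_set_scope.
Local Open Scope card_scope.

(** * Cardinality *)

Lemma injective_card_le (T U : Type) (f : T -> U) :
  injective f -> [set: T] #<= [set: U].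
Proof.
move=> finj.
have /unsquash h : $|{injfun [set: T] >-> [set: U]}|.
  by apply/injfunPex; exists f => // x y _ _; exact: finj.
exact: inj_card_le h.
Qed.

Lemma countable_enum (T : Type) (A : set T) (x0 : T) : countable A -> A x0 ->
  exists e : nat -> T, A = range e.
Proof.
move=> /pfcard_geP[->//|cA] _.
by have /surjfunPex[e Ae] := cA; exists e.
Qed.

Section CantorSum.
Local Open Scope ring_scope.
Variables (R : realType) (A : nat -> bool).

Definition cantor_psum (n : nat) : R := \sum_(k < n) (A k)%:R * 3^-1 ^+ k.

(** The coefficients 0 and 1 in base 3 leave gaps: the tail after position [k]
    is at most half of [3 ^- k]. *)
Definition cantor_sum : R := sup (range cantor_psum).

Lemma cantor_psumS n :
  cantor_psum n.+1 = cantor_psum n + (A n)%:R * 3^-1 ^+ n.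
Proof. by rewrite /cantor_psum big_ord_recr. Qed.

Lemma cantor_psum_le m n : (m <= n)%N -> cantor_psum m <= cantor_psum n.
Proof.
move=> /subnK <-; elim: (n - m)%N => // k IH.
rewrite addSn cantor_psumS (le_trans IH)// lerDl mulr_ge0// exprn_ge0//.
by rewrite invr_ge0.
Qed.

Lemma cantor_psum_tail m n :
  cantor_psum n <= cantor_psum m + 3 / 2 * 3^-1 ^+ m.
Proof.
have p k : 0 < 3^-1 ^+ k :> R by rewrite exprn_gt0// invr_gt0.
have [nm|/ltnW/subnK <-] := leqP n m.
  by rewrite (le_trans (cantor_psum_le nm))// lerDl; have := p m; lra.
set j := (n - m)%N.
suff H : cantor_psum (j + m) + 3 / 2 * 3^-1 ^+ (j + m) <=
         cantor_psum m + 3 / 2 * 3^-1 ^+ m.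
  by apply: le_trans H; rewrite lerDl; have := p (j + m)%N; lra.
elim: j => // j IH; apply: le_trans IH.
rewrite addSn cantor_psumS exprS; have := p (j + m)%N.
by case: (A _) => /=; lra.
Qed.

Lemma cantor_psum_ubound m :
  ubound (range cantor_psum) (cantor_psum m + 3 / 2 * 3^-1 ^+ m).
Proof. by move=> _ [n _ <-]; exact: cantor_psum_tail. Qed.

Lemma cantor_sum_ge m : cantor_psum m <= cantor_sum.
Proof.
apply: ub_le_sup; last by exists m.
by exists (cantor_psum 0 + 3 / 2 * 3^-1 ^+ 0); exact: cantor_psum_ubound.
Qed.

Lemma cantor_sum_le m : cantor_sum <= cantor_psum m + 3 / 2 * 3^-1 ^+ m.
Proof.
by apply: ge_sup; [exists (cantor_psum 0), 0%N | exact: cantor_psum_ubound].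
Qed.

End CantorSum.

Section CantorSumInj.
Local Open Scope ring_scope.
Variable R : realType.

Lemma cantor_sum_lt (A B : nat -> bool) m :
  (forall k, (k < m)%N -> A k = B k) -> B m -> ~~ A m ->
  cantor_sum R A < cantor_sum R B.
Proof.
move=> AB Bm /negbTE Am.
apply: le_lt_trans (cantor_sum_le R A m.+1) _.
apply: lt_le_trans (cantor_sum_ge R B m.+1).
rewrite !cantor_psumS Bm Am exprS.
have -> : cantor_psum R A m = cantor_psum R B m.
  by apply: eq_bigr => k _; rewrite AB.
have : 0 < 3^-1 ^+ m :> R by rewrite exprn_gt0// invr_gt0.
by rewrite /=; lra.
Qed.

Lemma cantor_sum_inj : injective (cantor_sum R).
Proof.
move=> A B AB; apply/funext => k; apply: contrapT => /eqP Nk.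
have [m Nm mmin] := ex_minnP (ex_intro (fun k => A k != B k) k Nk).
have {}mmin j : (j < m)%N -> A j = B j.
  by move=> jm; apply/eqP; apply: contraTT jm => /mmin; rewrite -leqNgt.
have [Bm|Bm] := boolP (B m).
  have /(cantor_sum_lt mmin Bm) : ~~ A m by move: Nm; rewrite Bm; case: (A m).
  by rewrite AB ltxx.
have Am : A m by move: Nm; rewrite (negbTE Bm); case: (A m).
have /(_ Am Bm) := cantor_sum_lt (fun j jm => esym (mmin j jm)).
by rewrite AB ltxx.
Qed.

End CantorSumInj.

Lemma card_power_le_real (R : realType) (C : countType) :
  [set: set C] #<= [set: R].
Proof.
pose d (A : set C) (n : nat) := if unpickle n is Some c then `[< A c >] else false.
apply: (@injective_card_le _ _ (fun A => cantor_sum R (d A))) => A B.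
move=> /cantor_sum_inj AB; apply/funext => c; apply/propext.
have := congr1 (fun f => f (pickle c)) AB; rewrite /d pickleK => e.
by split => /asboolP; [rewrite e|rewrite -e] => /asboolP.
Qed.

(** * Closure under countably infinitary operations *)

(** Formal expressions in the generator and the operations.  Building the closure
    from terms rather than by a transfinite iteration of length [omega_1] avoids
    any appeal to the regularity of [omega_1]. *)
Inductive term : Set :=
| Gen
| App of (nat -> nat) & (nat -> term).

(** The set of pairs (address of a node, point of the graph of the operation
    index standing there). *)
Fixpoint term_graph (t : term) : set (seq nat * (nat * nat)) :=
  match t with
  | Gen => set0
  | App g f => fun c =>
      match c.1 with
      | [::] => g c.2.1 = c.2.2
      | k :: s => term_graph (f k) (s, c.2)
      end
  end.

Lemma term_graph_inj : injective term_graph.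
Proof.
elim=> [|g f IH] [|g' f'] //= e.
- have : (set0 : set (seq nat * (nat * nat))) ([::], (0, g' 0)) by rewrite e.
  by [].
- have : (set0 : set (seq nat * (nat * nat))) ([::], (0, g 0)) by rewrite -e.
  by [].
have -> : g = g'.
  apply/funext => n; have := congr1 (fun A => A ([::], (n, g' n))) e.
  by move=> /= ->.
congr App; apply/funext => k; apply: IH; apply/funext => -[s c].
by have := congr1 (fun A => A (k :: s, c)) e.
Qed.

Fixpoint term_eval (T : Type) (x0 : T) (op : (nat -> nat) -> (nat -> T) -> T)
    (t : term) : T :=
  match t with
  | Gen => x0
  | App g f => op g (fun n => term_eval x0 op (f n))
  end.

Lemma omega_ary_closure (R : realType) (T : Type) (x0 : T)
    (op : (nat -> nat) -> (nat -> T) -> T) :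
  exists A : set T,
    [/\ A x0, forall g u, (forall n, A (u n)) -> A (op g u) & A #<= [set: R]].
Proof.
exists (range (term_eval x0 op)); split; first by exists Gen.
  move=> g u uA; have /choice[t tu] n : exists t, term_eval x0 op t = u n.
    by have [t _ tun] := uA n; exists t.
  exists (App g t) => //=.
  by congr op; apply/funext.
apply: card_le_trans (card_image_le _ _) _.
apply: card_le_trans (card_power_le_real R _).
exact: injective_card_le term_graph_inj.
Qed.

(** * The cardinality of first-countable Lindelof Hausdorff spaces *)

Section Arhangelskii.
Variable X : topologicalType.

(** The base is made decreasing so that picking one point in each member
    produces a sequence converging to [x]. *)
Lemma decreasing_base : first_countable X ->
  exists U : X -> nat -> set X,
    [/\ forall x n, nbhs x (U x n),
        forall x V, nbhs x V -> exists n, U x n `<=` V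
      & forall x m n, (m <= n)%N -> U x n `<=` U x m].
Proof.
move=> fcX.
suff H (x : X) : exists U : nat -> set X,
    [/\ forall n, nbhs x (U n), forall V, nbhs x V -> exists n, U n `<=` V
      & forall m n, (m <= n)%N -> U n `<=` U m].
  have [U UP] := choice H; exists U.
  by split=> x; have [] := UP x.
have [B cB Bx] := fcX x.
have [b0 Bb0] : B !=set0.
  have : nbhs x setT by exact: filterT.
  by rewrite -Bx => -[b Bb _]; exists b.
have [e eB] := countable_enum cB Bb0.
have nbhs_e n : nbhs x (e n).
  by rewrite -Bx; exists (e n) => //; rewrite eB; exists n.
pose U := fix U n := if n is m.+1 then U m `&` e m.+1 else e 0.
have Ue n : U n `<=` e n by case: n => //= n y [].
exists U; split.
- by elim=> [|n IH] /=; [exact: nbhs_e|exact: filterI].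
- move=> V; rewrite -Bx => -[b]; rewrite eB => -[n _ <-] nV.
  by exists n; exact: subset_trans (Ue n) nV.
move=> m n /subnK <-; elim: (n - m)%N => // k IH.
by rewrite addSn => y [/IH].
Qed.

Lemma Arhangelskii (R : realType) :
  hausdorff_space X -> first_countable X -> Lindelof X ->
  [set: X] #<= [set: R].
Proof.
move=> hX /decreasing_base[U [Ux Ubase Udec]] LX.
have [[x0]|X0] := pselect (inhabited X); last first.
  by apply: (@injective_card_le _ _ (fun=> 0%R)) => x; case: X0.
(* the value of [g] at 0 selects limits or escaping; the base indices of the
   neighbourhoods to escape from are the later values of [g] *)
pose op (g : nat -> nat) (u : nat -> X) :=
  if g 0 is 0 then xget x0 [set p | u @ \oo --> p]
  else xget x0 [set p | forall n, ~ U (u n) (g n.+1) p].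
have [A [Ax0 Aop Acard]] := omega_ary_closure R x0 op.
suff -> : [set: X] = A by [].
have clA : closed A.
  move=> p pA.
  have /choice[u uP] n : exists y, A y /\ U p n y.
    by have [y] := pA _ (Ux p n); exists y.
  have up : u @ \oo --> p.
    move=> V /Ubase[n nV]; exists n => // m /= nm.
    by apply: nV; apply: Udec nm _ _; exact: (uP m).2.
  have := Aop (fun=> 0) u (fun n => (uP n).1).
  rewrite /op (xget_subset1 x0 up) //; exact: cvg_unique.
apply/seteqP; split => // q _; apply: contrapT => Nq.
pose F (V : set X) := V = ~` A \/
  exists a n, [/\ A a, ~ U a n q & V = (U a n)°].
have sep a : A a -> exists n, ~ U a n q.
  move=> Aa; have /(hausdorff_accessible hX)[V [oV]] : a != q.
    by apply/eqP => aq; apply: Nq; rewrite -aq.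
  rewrite !inE => aV qV; have [n nV] := Ubase a V (open_nbhs_nbhs (conj oV aV)).
  by exists n => /nV.
have [n0 n0P] := sep _ Ax0.
have [||G [GF cG Gcov]] := LX F.
- by move=> V [->|[a [n [_ _ ->]]]]; [exact: closed_openC|exact: open_interior].
- apply/seteqP; split => // y _; have [Ay|NAy] := pselect (A y).
    have [n nP] := sep y Ay; exists (U y n)°; first by right; exists y, n.
    exact: nbhs_singleton (nbhs_interior (Ux y n)).
  by exists (~` A) => //; left.
have [V0 GV0] : G !=set0.
  by have : cover G id q by [rewrite Gcov]; move=> [V GV _]; exists V.
have [e eG] := countable_enum cG GV0.
(* the member [~` A] of the subcover is replaced by a neighbourhood of [x0] *)
have /choice[c cP] k : exists c : X * nat,
    [/\ A c.1, ~ U c.1 c.2 q & e k `&` A `<=` U c.1 c.2].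
  have : F (e k) by apply: GF; rewrite eG; exists k.
  move=> [->|[a [n [Aa Nn ->]]]].
    by exists (x0, n0); split => // y [].
  by exists (a, n); split => // y [/interior_subset].
pose g n := if n is k.+1 then (c k).2 else 1.
have esc : [set p | forall n, ~ U (c n).1 (g n.+1) p] q.
  by move=> n; have [] := cP n.
have Aop_q : A (op g (fun n => (c n).1)).
  by apply: Aop => n; have [] := cP n.
have : cover G id (op g (fun n => (c n).1)) by rewrite Gcov.
rewrite eG => -[_ [k _ <-] /= ek].
have [_ _ /(_ _ (conj ek Aop_q))] := cP k.
by have := xgetI x0 esc k.
Qed.

End Arhangelskii.

(** * Derivatives below the height *)

Section Height.
Variable X : topologicalType.

(** The points of [A] isolated in [A] are its intersection with the union of the
    open sets that meet [A] in a single point. *)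
Lemma closed_non_isolated (A : set X) : closed A -> closed (non_isolated A).
Proof.
move=> cA; suff -> : non_isolated A = A `&` ~` (\bigcup_(V in [set V | open V /\
    exists x, V `&` A = [set x]]) V).
  apply: closedI => //; apply: open_closedC; apply: bigcup_open => V.
  by case.
apply/seteqP; split => y [Ay Ny]; split => //.
  move=> [V [oV [x Vx]] Vy]; apply: Ny; split; first exact: mem_set.
  exists V; first exact: open_nbhs_nbhs.
  have : (V `&` A) y by [].
  by rewrite Vx => ->.
move=> [_ [V Vy VA]]; apply: Ny; exists V°; last first.
  exact: nbhs_singleton (nbhs_interior Vy).
split; first exact: open_interior.
exists y; apply/seteqP; split => z.
  by move=> [/interior_subset Vz Az]; rewrite -VA.
by move=> ->; split => //; exact: nbhs_singleton (nbhs_interior Vy).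
Qed.

Lemma closed_CB_below (a : Ord) (x : a) : closed (CB_below (X := X) x).
Proof.
elim/olt_ind: x => x IH; rewrite CB_belowE.
have -> : [set p | forall y, olt y x -> non_isolated (CB_below y) p] =
    \bigcap_(y in [set y | olt y x]) non_isolated (CB_below (X := X) y) by [].
by apply: closed_bigI => y yx; exact/closed_non_isolated/IH.
Qed.

(** Otherwise, by minimality, the height would embed in its own proper initial segment below [x]. *)
Lemma CB_below_height_neq0 : scattered X ->
  forall x : scattered_height X, CB_below (X := X) x !=set0.
Proof.
move=> sX x; apply/set0P/eqP => x0.
have : CB_deriv X (iseg x) = set0.
  rewrite -x0; apply: (CB_deriv_seg (f := fun y : iseg x => sval y)) => //.
  by move=> z; split => [zx|[[y yx] <-]//]; exists (exist _ z zx).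
move=> /(scattered_heightP sX).2[h [hmono _]].
(* a strictly increasing self-map cannot take a value below its argument *)
suff below y : ~ olt (sval (h y)) y by case: (below x); case: (h x).
elim/olt_ind: y => y IH hy; apply: (IH _ hy); exact: hmono.
Qed.

Lemma card_height : scattered X -> [set: scattered_height X] #<= [set: X].
Proof.
move=> sX.
have /choice[f fP] (x : scattered_height X) :
  exists p, isolated (CB_below (X := X) x) p := sX _ (CB_below_height_neq0 sX x).
have fN x y : olt x y -> f x <> f y.
  move=> xy fxy; have := isolatedS (fP y); rewrite CB_belowE => /(_ _ xy)[_].
  by rewrite -fxy; apply; exact: fP.
apply: (@injective_card_le _ _ f) => x y fxy.
by case: (olt_total x y) => [/fN//|[//|/fN]]; rewrite fxy.
Qed.

(** If an index [x] bounded strictly the indices [e n] of a countable subcover,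
    a point of the [x]-th derivative would lie in no member of it. *)
Lemma countable_cofinal_height : scattered X -> Lindelof X ->
  scattered_height X ->
  exists e : nat -> scattered_height X,
    forall x, exists n, x = e n \/ olt x (e n).
Proof.
move=> sX LX x0.
pose D (x : scattered_height X) : set X := non_isolated (CB_below (X := X) x).
have [||G [GF cG Gcov]] := LX [set ~` D x | x in setT].
- by move=> _ [x _ <-]; exact/closed_openC/closed_non_isolated/closed_CB_below.
- apply/seteqP; split => // p _; apply: contrapT => Np.
  suff : CB_deriv X (scattered_height X) p.
    by rewrite (scattered_heightP sX).1.
  by move=> x _; apply: contrapT => Dx; apply: Np; exists (~` D x).
have [p _] := CB_below_height_neq0 sX x0.
have [V0 GV0] : G !=set0.
  by have : cover G id p by [rewrite Gcov]; move=> [V GV _]; exists V.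
have [E EG] := countable_enum cG GV0.
have /choice[e eP] n : exists x, ~` D x = E n.
  have /GF[x _ xE] : G (E n) by rewrite EG; exists n.
  by exists x.
exists e => x; apply: contrapT => Nx.
have [q] := CB_below_height_neq0 sX x; rewrite CB_belowE => qx.
have : cover G id q by rewrite Gcov.
rewrite EG => -[_ [n _ <-] /=]; rewrite -eP; apply; apply: qx.
case: (olt_total (e n) x) => // -[nx|xn]; case: Nx; exists n; last by right.
by left.
Qed.

End Height.

(** * Cardinality, height and cofinality of FLS spaces *)

Theorem proposition5p1 (R : realType) (X : topologicalType) (hX : FLS X) :
  [/\ [set: X] #<= [set: R],
      Ord_lt (scattered_height X) (card_succ R)
    & Ord_le (cf (scattered_height X)) omega].
Proof.
have [hausX fcX LX sX] := hX.
have XR : [set: X] #<= [set: R] by exact: Arhangelskii.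
split => //.
  case: (Ord_leVlt (card_succ R) (scattered_height X)) => // -[f [fmono _]].
  case: (card_succP R).1.
  apply: card_le_trans XR; apply: card_le_trans (card_height sX).
  apply: (@injective_card_le _ _ f) => x y fxy.
  by case: (olt_total x y) => [/fmono|[//|/fmono]]; rewrite fxy => /olt_irr.
have [[x0]|h0] := pselect (inhabited (scattered_height X)).
  by apply: (cfP _).2; exact: countable_cofinal_height.
have [f [fmono frange]] : Ord_le (scattered_height X) omega.
  by exists (fun=> 0); split=> x; case: h0.
have : Ord_le (cf (scattered_height X)) (scattered_height X).
  by apply: (cfP _).2; exists id => x; exists x; left.
by move=> [g _]; exists (fun=> 0); split => x; case: h0; constructor; exact: g x.
Qed.
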